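(* Let $\mathcal L:\bigcup_{n\ge1}\mathcal P_n\to\mathbb R$ be the ContinuouSP loss as a function of a single datum, $$\mathcal L(A,X,L)=\frac1m\left(\beta H_\theta(A,X,L)+\sum_{j=1}^\infty(1-q)^{j-1}q\,\log Z(\theta,\beta,A')\right)+R(\theta),\qquad A'=\mathrm{Expand}(\mathrm{Reduce}(A),j),$$ where $R(\theta)$ does not depend on $(A,X,L)$. Then $\mathcal L$ is strongly re-description invariant. Moreover, the induced map $\mathcal L\circ\mathrm{PtoS}^{-1}:\mathrm{PtoS}(\bigcup_{n\ge1}\mathcal P_n)\to\mathbb R$ is translation invariant, rotation invariant, and continuous (in the sense of continuity on solid materials).
   Context: **Solid materials.** Let $\mathbb A$ be the (finite) set of atomic species. $\mathcal S$ is the set of all countable subsets of $\mathbb A\times\mathbb R^{3\times1}$; its elements are called solid materials. Let $f:\mathcal S\rightharpoonup\mathcal Y$ be a partial map into a set $\mathcal Y$. - $f$ is translation invariant if for all $S\in\mathrm{Dom}(f)$ and $b\in\mathbb R^{3\times 1}$, $f(\{(a,x+b)\mid(a,x)\in S\})=f(S)$. - $f$ is rotation invariant if for all $S\in\mathrm{Dom}(f)$ and $Q\in\mathrm O(3)$, $f(\{(a,Qx)\mid(a,x)\in S\})=f(S)$. - If $\mathcal Y=\mathbb R^r$, $f$ is continuous at $S$ if for every $\varepsilon>0$ there is $\delta>0$ such that for every $S'\in\mathrm{Dom}(f)$: if there is a bijection $\phi:S\to S'$ such that, writing $\phi(a,x)=(a',x')$, one has $a'=a$ and $\|x'-x\|<\delta$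 for all $(a,x)\in S$, then $\|f(S')-f(S)\|<\varepsilon$. $f$ is continuous if it is continuous at every $S\in\mathrm{Dom}(f)$. **Periodic units.** $\mathcal P_n$ is the set of $(A,X,L)$ with $A=(a_1,\dots,a_n)\in\mathbb A^n$ (species vector), $X=(x_1,\dots,x_n)\in\mathbb R^{3\times n}$ (coordinate matrix), $L\in\mathbb R^{3\times3}$ invertible (lattice basis), such that $x_j+Lk\neq x_i$ for all $i,j\in\{1,\dots,n\}$, $k\in\mathbb Z^{3\times1}$ with $i\ne j$ or $k\neq0$. Define $\mathrm{PtoS}:\bigcup_{n\ge1}\mathcal P_n\to\mathcal S$ by $\mathrm{PtoS}(A,X,L)=\{(a_i,x_i+Lk)\mid i\in\{1,\dots,n\},\,k\in\mathbb Z^{3\times1}\}$. A map $g:\bigcup_{n\ge1}\mathcal P_n\to\mathcal Y$ is strongly re-description invariant if for all $P,P'\in\bigcup_n\mathcal P_n$, $\mathrm{PtoS}(P')=\mathrm{PtoS}(P)$ implies $g(P')=g(P)$; then $g\circ\mathrm{PtoS}^{-1}$ denotes the unique map $f:\mathrm{PtoS}(\bigcup_n\mathcal P_n)\to\mathcal Y$ with $f\circ\mathrm{PtoS}=g$, regarded as a partial map on $\mathcal S$. **The energy function.** Fix the parameters $\theta$, a cutoff distance $D>0$, and dimensions $d_{\mathrm v},d_{\mathrm e}$. For $P=(A,X,L)\in\mathcal P_n$ and $i\in\{1,\dots,n\}$ put $\mathrm N_P(i)=\{(j,k)\mid j\in\{1,\dots,n\},\,k\in\mathbb Z^{3\times1},\,\|x_j+Lk-x_i\|<D\}$.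 For $(j,k)\in\mathrm N_P(i)$ let $e_{i,j,k}\in\mathbb R^{d_{\mathrm e}}$ be an edge feature that is a fixed continuous function of the distance $\|x_j+Lk-x_i\|$. Each node $i$ has a feature $v_i\in\mathbb R^{d_{\mathrm v}}$ initialized as a fixed function of the species $a_i$. A fixed number of times, all node features are simultaneously updated by $$v_i\leftarrow v_i+\sum_{(j,k)\in\mathrm N_P(i)}\cos^2\!\left(\frac{\pi\|x_j+Lk-x_i\|}{2D}\right)\psi_\theta(v_i,v_j,e_{i,j,k}),$$ where $\psi_\theta:\mathbb R^{d_{\mathrm v}}\times\mathbb R^{d_{\mathrm v}}\times\mathbb R^{d_{\mathrm e}}\to\mathbb R^{d_{\mathrm v}}$ is continuous. Then $H_\theta(P)=\mathrm{CGCNN}_\theta'(P)\in\mathbb R$ is the value of a fixed multi-layer perceptron (a continuous map $\mathbb R^{d_{\mathrm v}}\to\mathbb R$) at the mean $\frac1n\sum_{i=1}^n v_i$ of the final node features. **Ingredients of the loss.** $m$ is a positive integer (the number of data), $\beta>0$ is the inverse temperature, and $q$ is the success probability of a geometric distribution, with mass $(1-q)^{j-1}q$ at $j\in\{1,2,\dots\}$. For a species vector $A$ of length $n$, $$Z(\theta,\beta,A)=\int_{X\in\mathbb R^{3\times n},\,L\in\mathbb R^{3\times3}}\exp(-\beta H_\theta(A,X,L))\,\mathrm dX\,\mathrm dL .$$ $\mathrm{Reduce}(A)$ is the composition of $A$: the simplest integer ratio of the atomic counts of the species in $A$ (counts divided by their greatest common divisor). $\mathrm{Expand}(c,j)$ is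 a species vector whose atomic counts are $j$ times the composition $c$ (the order of the entries is immaterial). $R(\theta)$ is the contribution of the other data points.
   Formalization: Since the integrand of Z is positive and invariant under translating X, Z is always +∞ and the loss as written is not real-valued; the formal loss evaluates the series of log Z in the extended reals and replaces an infinite value by 0. *)

(* Defs.v *)
From HB Require Import structures.
From mathcomp Require Import all_boot all_order all_algebra.
From mathcomp Require Import all_classical all_reals all_analysis.

Set Implicit Arguments.
Unset Strict Implicit.
Unset Printing Implicit Defensive.

Import Order.TTheory GRing.Theory Num.Theory.
Import numFieldNormedType.Exports.

Local Open Scope classical_set_scope.
Local Open Scope ring_scope.

(* The norm that the library puts on matrices is the sup norm. *)
Definition enorm (R : realType) (d : nat) (x : 'cV[R]_d) : R :=
  Num.sqrt (\sum_(i < d) x i ord0 ^+ 2).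

Record material (R : realType) (Sp : finType) := Material {
  sites :> set (Sp * 'cV[R]_3) ;
  sites_countable : countable sites }.

Lemma countable_image_material (R : realType) (Sp : finType)
    (h : Sp * 'cV[R]_3 -> Sp * 'cV[R]_3) (S : material R Sp) :
  countable (h @` S).
Proof. exact/(sub_countable (card_image_le _ _))/sites_countable. Qed.

Definition translate (R : realType) (Sp : finType) (b : 'cV[R]_3)
    (S : material R Sp) : material R Sp :=
  Material (countable_image_material (fun p => (p.1, p.2 + b)) S).

Definition rotate (R : realType) (Sp : finType) (Q : 'M[R]_3)
    (S : material R Sp) : material R Sp :=
  Material (countable_image_material (fun p => (p.1, Q *m p.2)) S).

Definition orthogonal_mx (R : realType) (d : nat) (Q : 'M[R]_d) : Prop :=
  Q^T *m Q = 1%:M.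

(* A partial map is an [option]-valued function: its domain consists of the
   materials not sent to [None].  In particular, the equations in the two
   invariance properties say that the moved material is in the domain too. *)
Definition partial_map (R : realType) (Sp : finType) (Y : Type) :=
  material R Sp -> option Y.

Definition in_dom (R : realType) (Sp : finType) (Y : Type)
    (f : partial_map R Sp Y) (S : material R Sp) : Prop := f S <> None.

Definition translation_invariant (R : realType) (Sp : finType) (Y : Type)
    (f : partial_map R Sp Y) : Prop :=
  forall (S : material R Sp) (b : 'cV[R]_3),
    in_dom f S -> f (translate b S) = f S.

Definition rotation_invariant (R : realType) (Sp : finType) (Y : Type)
    (f : partial_map R Sp Y) : Prop :=
  forall (S : material R Sp) (Q : 'M[R]_3),
    in_dom f S -> orthogonal_mx Q -> f (rotate Q S) = f S.

Definition displaced_below (R : realType) (Sp : finType) (delta : R)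
    (S S' : material R Sp) : Prop :=
  exists phi : Sp * 'cV[R]_3 -> Sp * 'cV[R]_3,
    set_bij S S' phi /\
    forall p, sites S p -> (phi p).1 = p.1 /\ enorm ((phi p).2 - p.2) < delta.

Definition material_continuous_at (R : realType) (Sp : finType)
    (V : normedModType R) (f : partial_map R Sp V) (S : material R Sp) (y : V) : Prop :=
  forall eps : R, 0 < eps -> exists2 delta : R, 0 < delta &
    forall (S' : material R Sp) (y' : V), f S' = Some y' ->
      displaced_below delta S S' -> `|y' - y| < eps.

Definition material_continuous (R : realType) (Sp : finType)
    (V : normedModType R) (f : partial_map R Sp V) : Prop :=
  forall (S : material R Sp) (y : V),
    f S = Some y -> material_continuous_at f S y.

Definition lattice_vec (R : realType) (L : 'M[R]_3) (k : 'cV[int]_3) :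
  'cV[R]_3 := L *m map_mx intr k.

Definition is_periodic_unit (R : realType) (n : nat)
    (X : 'M[R]_(3, n)) (L : 'M[R]_3) : Prop :=
  L \in unitmx /\
  forall (i j : 'I_n) (k : 'cV[int]_3), i <> j \/ k <> 0 ->
    col j X + lattice_vec L k <> col i X.

(* The disjoint union of the sets of periodic units with [n >= 1] atoms. *)
Record periodic_unit (R : realType) (Sp : finType) := PeriodicUnit {
  natoms : nat ;
  natoms_gt0 : (0 < natoms)%N ;
  species : natoms.-tuple Sp ;
  coords : 'M[R]_(3, natoms) ;
  lattice : 'M[R]_3 ;
  periodic_unitP : is_periodic_unit coords lattice }.

Definition PtoS_set (R : realType) (Sp : finType) (P : periodic_unit R Sp) :
    set (Sp * 'cV[R]_3) :=
  [set p | exists (i : 'I_(natoms P)) (k : 'cV[int]_3),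
     p = (tnth (species P) i, col i (coords P) + lattice_vec (lattice P) k)].

Lemma PtoS_countable (R : realType) (Sp : finType) (P : periodic_unit R Sp) :
  countable (PtoS_set P).
Proof.
pose h (ik : 'I_(natoms P) * 'cV[int]_3) :=
  (tnth (species P) ik.1,
   col ik.1 (coords P) + lattice_vec (lattice P) ik.2).
have -> : PtoS_set P = h @` setT.
  apply/seteqP; split=> p /=; first by case=> i [k ->]; exists (i, k).
  by case=> -[i k] _ <-; exists i, k.
apply: (sub_countable (card_image_le _ _)); exact: countableP.
Qed.

Definition PtoS (R : realType) (Sp : finType) (P : periodic_unit R Sp) :
  material R Sp := Material (PtoS_countable P).

Definition strongly_redescription_invariant (R : realType) (Sp : finType)
    (Y : Type) (g : periodic_unit R Sp -> Y) : Prop :=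
  forall P P' : periodic_unit R Sp, PtoS P' = PtoS P -> g P' = g P.

(* [g \o PtoS^-1], with domain the range of [PtoS].  The choice of a preimage
   is irrelevant when [g] is strongly re-description invariant; see
   [descend_PtoS]. *)
Definition descend (R : realType) (Sp : finType) (Y : Type)
    (g : periodic_unit R Sp -> Y) : partial_map R Sp Y :=
  fun S => match pselect (exists P, PtoS P = S) with
           | left exP => Some (g (projT1 (cid exP)))
           | right _ => None
           end.

Lemma descend_PtoS (R : realType) (Sp : finType) (Y : Type)
    (g : periodic_unit R Sp -> Y) :
  strongly_redescription_invariant g ->
  forall P, descend g (PtoS P) = Some (g P).
Proof.
move=> ginv P; rewrite /descend; case: pselect => [exP|]; last by case; exists P.
by case: cid => P' /= eP; rewrite (ginv _ _ eP).
Qed.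

Lemma in_dom_descend (R : realType) (Sp : finType) (Y : Type)
    (g : periodic_unit R Sp -> Y) (S : material R Sp) :
  in_dom (descend g) S <-> range (@PtoS R Sp) S.
Proof.
rewrite /in_dom /descend; case: pselect => [[P eP]|nP].
  by split=> // _; exists P.
by split=> [//|[P _ eP]]; case: nP; exists P.
Qed.

(* The network for one fixed value of its trainable parameters; [readout]
   plays the role of the final multi-layer perceptron. *)
Record network (R : realType) (Sp : finType) := Network {
  dv : nat ;
  de : nat ;
  cutoff : R ;
  cutoff_gt0 : 0 < cutoff ;
  rounds : nat ;
  node_init : Sp -> 'cV[R]_dv ;
  edge_feature : R -> 'cV[R]_de ;
  edge_feature_continuous : {within [set t | 0 <= t], continuous edge_feature} ;
  message : 'cV[R]_dv -> 'cV[R]_dv -> 'cV[R]_de -> 'cV[R]_dv ;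
  message_continuous :
    continuous (fun z : 'cV[R]_dv * 'cV[R]_dv * 'cV[R]_de =>
                  message z.1.1 z.1.2 z.2) ;
  readout : 'cV[R]_dv -> R ;
  readout_continuous : continuous readout }.

Section energy.
Variables (R : realType) (Sp : finType) (N : network R Sp).
Variables (n : nat) (A : n.-tuple Sp) (X : 'M[R]_(3, n)) (L : 'M[R]_3).

Definition neighbor_dist (i : 'I_n) (jk : 'I_n * 'cV[int]_3) : R :=
  enorm (col jk.1 X + lattice_vec L jk.2 - col i X).

Definition neighbors (i : 'I_n) : set ('I_n * 'cV[int]_3) :=
  [set jk | neighbor_dist i jk < cutoff N].

(* The neighborhoods are finite as soon as [L] is invertible, so that the
   finitely supported sum is the sum over all the neighbors. *)
Definition update (v : 'I_n -> 'cV[R]_(dv N)) : 'I_n -> 'cV[R]_(dv N) :=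
  fun i => v i +
    \sum_(jk \in neighbors i)
      (cos (pi * neighbor_dist i jk / (2 * cutoff N)) ^+ 2) *:
        message (v i) (v jk.1) (edge_feature N (neighbor_dist i jk)).

Definition node_features : 'I_n -> 'cV[R]_(dv N) :=
  iter (rounds N) update (fun i => node_init N (tnth A i)).

Definition energy_of : R :=
  readout ((n%:R)^-1 *: \sum_(i < n) node_features i).

End energy.

Definition energy (R : realType) (Sp : finType) (N : network R Sp)
    (P : periodic_unit R Sp) : R :=
  energy_of N (species P) (coords P) (lattice P).

Section power_measure.
Context d (T : measurableType d) (R : realType).
Variable nu : {sigma_finite_measure set T -> \bar R}.
Local Open Scope ereal_scope.

Definition cons_pair (n : nat) (w : T * n.-tuple T) : n.+1.-tuple T :=
  [tuple of w.1 :: w.2].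

Lemma measurable_cons_pair (n : nat) : measurable_fun setT (@cons_pair n).
Proof. exact: (measurable_cons measurable_fst measurable_snd). Qed.

Section step.
Variables (n : nat) (mu : {sigma_finite_measure set (n.-tuple T) -> \bar R}).

Definition cons_measure : set (n.+1.-tuple T) -> \bar R :=
  pushforward (nu \x mu) (@cons_pair n).

Let cons_measure0 : cons_measure set0 = 0.
Proof. by rewrite /cons_measure /pushforward preimage_set0 measure0. Qed.

Let cons_measure_ge0 B : 0 <= cons_measure B.
Proof. by apply: integral_ge0 => x _; exact: measure_ge0. Qed.

Let cons_measure_sigma_additive : semi_sigma_additive cons_measure.
Proof.
move=> F mF tF mUF; rewrite /cons_measure /pushforward preimage_bigcup.
apply: measure_semi_sigma_additive.
- move=> k; rewrite -[X in measurable X]setTI.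
  exact: measurable_cons_pair.
- apply/trivIsetP => /= i j _ _ ij; rewrite -preimage_setI.
  by move/trivIsetP : tF => /(_ _ _ _ _ ij) ->//; rewrite preimage_set0.
- rewrite -preimage_bigcup -[X in measurable X]setTI.
  exact: measurable_cons_pair.
Qed.

HB.instance Definition _ := isMeasure.Build _ _ _ cons_measure
  cons_measure0 cons_measure_ge0 cons_measure_sigma_additive.

Let cons_measure_sigma_finite : sigma_finite setT cons_measure.
Proof.
have /sigma_finiteP[F [FT ndF Foo]] := sigma_finiteT nu.
have /sigma_finiteP[G [GT ndG Goo]] := sigma_finiteT mu.
pose g (t : n.+1.-tuple T) : T * n.-tuple T := (thead t, [tuple of behead t]).
have mg : measurable_fun setT g.
  apply/measurable_fun_pairP; split; last exact: measurable_behead.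
  exact: (measurable_tnth ord0).
have gK : cancel (@cons_pair n) g.
  by case=> x t; rewrite /g /cons_pair; congr pair; exact/val_inj.
exists (fun k => g @^-1` (F k `*` G k)).
  apply/seteqP; split=> // t _.
  have [k _ Fk] : (\bigcup_k F k) (g t).1 by rewrite -FT.
  have [l _ Gl] : (\bigcup_k G k) (g t).2 by rewrite -GT.
  exists (maxn k l) => //; split.
  - by move: Fk; exact/subsetPset/ndF/leq_maxl.
  - by move: Gl; exact/subsetPset/ndG/leq_maxr.
move=> k; have [mF Fkoo] := Foo k; have [mG Gkoo] := Goo k; split.
  by rewrite -[X in measurable X]setTI; apply: mg => //; exact: measurableX.
rewrite /cons_measure /pushforward -comp_preimage.
have -> : g \o @cons_pair n = id by apply/funext => w /=; rewrite gK.
by rewrite preimage_id product_measure1E// lte_mul_pinfty// ge0_fin_numE.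
Qed.

HB.instance Definition _ := Measure_isSigmaFinite.Build _ _ _ cons_measure
  cons_measure_sigma_finite.

End step.

Fixpoint power_measure (n : nat) :
    {sigma_finite_measure set (n.-tuple T) -> \bar R} :=
  match n with
  | 0 => dirac [tuple]
  | n'.+1 => cons_measure (power_measure n')
  end.

End power_measure.

Definition lebesgue_tuple (R : realType) (n : nat) :
    {sigma_finite_measure set (n.-tuple (measurableTypeR R)) -> \bar R} :=
  power_measure (@lebesgue_measure R) n.

Definition mx_of_tuple (R : realType) (p q : nat)
    (t : (p * q).-tuple (measurableTypeR R)) : 'M[R]_(p, q) :=
  \matrix_(i, j) tnth t (mxvec_index i j).

(* The energy is only defined on periodic units; those [(X, L)] that do not
   form one are a null set and are left out of the domain of integration. *)
Definition partition_function (R : realType) (Sp : finType) (N : network R Sp)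
    (beta : R) (n : nat) (A : n.-tuple Sp) : \bar R :=
  (\int[lebesgue_tuple R (3 * n) \x lebesgue_tuple R (3 * 3)]_(w in
      [set w | is_periodic_unit (mx_of_tuple w.1) (mx_of_tuple w.2)])
     (expR (- beta * energy_of N A (mx_of_tuple w.1) (mx_of_tuple w.2)))%:E)%E.

Definition reduce (Sp : finType) (A : seq Sp) : {ffun Sp -> nat} :=
  [ffun a => (count_mem a A %/ \big[gcdn/0%N]_(b : Sp) count_mem b A)%N].

Definition is_expand (Sp : finType)
    (expand : {ffun Sp -> nat} -> nat -> seq Sp) : Prop :=
  forall (c : {ffun Sp -> nat}) (j : nat) (a : Sp),
    count_mem a (expand c j) = (j * c a)%N.

(* Evaluated in the extended reals: a translation-invariant energy makes the
   integral over all of [R^(3 x n)] diverge. *)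
Definition expected_log_partition (R : realType) (Sp : finType)
    (N : network R Sp) (expand : {ffun Sp -> nat} -> nat -> seq Sp)
    (beta q : R) (c : {ffun Sp -> nat}) : \bar R :=
  (\sum_(1 <= j <oo)
     ((1 - q) ^+ j.-1 * q)%:E *
       lne (partition_function N beta (in_tuple (expand c j))))%E.

(* [fine] is the identity on real values and sends the infinities to [0]: the
   loss is real even when the normalization term, which depends only on the
   composition, is infinite. *)
Definition loss (R : realType) (Sp : finType) (N : network R Sp)
    (expand : {ffun Sp -> nat} -> nat -> seq Sp) (m : nat) (beta q rest : R)
    (P : periodic_unit R Sp) : R :=
  (m%:R)^-1 * (beta * energy N P +
    fine (expected_log_partition N expand beta q (reduce (species P)))) + rest.

(* Main.v *)
(** The energy is a mean over the atoms of one cell of node features that only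
    depend on the material around each atom.  A bijection between two
    materials that moves every atom by less than [delta] distorts all distances
    by less than [2 * delta]; as a message is weighted by an envelope vanishing
    at the cutoff, induction on the rounds shows that corresponding atoms have
    uniformly close features when [delta] is small.  To compare the means over
    two unrelated cells, count in a large box of cells of the first material the
    atoms sent to each atom type of the second one: since the bijection is
    coarsely Lipschitz, these counts differ from one another by at most the
    number of atoms near the boundary of the box, so that all the types get
    asymptotically the same share.  Applied to the indicators of the species,
    the same comparison shows that the composition is preserved exactly.
    Re-description invariance is the case where the bijection is the identity,
    which is a displacement by less than every [delta]. *)
Require Import Defs.
From mathcomp Require Import all_boot all_order all_algebra.
From mathcomp Require Import all_classical all_reals all_analysis.
From mathcomp Require Import ring lra zify.
Import Order.TTheory GRing.Theory Num.Theory.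
Import numFieldNormedType.Exports.
Local Open Scope ring_scope.

Set Implicit Arguments.
Unset Strict Implicit.
Unset Printing Implicit Defensive.

(** * Cubes of lattice cells and their boundaries *)

(** The cube of [r ^ d] cells with coordinates from [- c] to [r - c - 1], indexed by a finite type
    so that its sites can be counted. *)
Definition box (d c r : nat) (k : 'cV['I_r]_d) : 'cV[int]_d :=
  \col_i ((k i ord0)%:Z - c%:Z).

Lemma box_inj (d c r : nat) : injective (@box d c r).
Proof.
move=> k l /matrixP kl; apply/matrixP => i j; rewrite ord1.
by move: (kl i ord0); rewrite !mxE => /addIr [] /val_inj.
Qed.

Lemma box_surj (d c r : nat) (z : 'cV[int]_d) :
  (forall i, - c%:Z <= z i ord0 < r%:Z - c%:Z) -> exists k : 'cV['I_r]_d, box c k = z.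
Proof.
move=> zb; have zr i : (absz (z i ord0 + c%:Z)%R < r)%N by have := zb i; lia.
exists (\col_i Ordinal (zr i)); apply/matrixP => i j.
have -> : j = ord0 by exact: ord1.
by rewrite !mxE /=; have := zb i; lia.
Qed.

(** A form of Bernoulli's inequality, by induction from [1 - x ^+ d.+1 = (1 - x) + x * (1 - x ^+
    d)]. *)
Lemma onem_exp_le (R : realFieldType) (x : R) (d : nat) :
  0 <= x <= 1 -> 1 - x ^+ d <= d%:R * (1 - x).
Proof.
move=> /andP[x0 x1]; elim: d => [|d IH]; first by rewrite expr0 mul0r subrr.
have : x * (1 - x ^+ d) <= d%:R * (1 - x).
  apply: le_trans IH; rewrite ler_piMl// subr_ge0 exprn_ile1//.
by rewrite exprS -natr1 mulrDl mul1r mulrBr mulr1; lra.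
Qed.

(** The shell between cubes of sides [s] and [s + a] has relative volume [1 - (s / (s + a)) ^+ d],
    at most [d * a / (s + a)], which tends to 0 as [s] grows. *)
Lemma box_boundary_small (R : realType) (d a : nat) (eta : R) : 0 < eta ->
  exists2 s : nat, (0 < s)%N &
    ((s + a) ^ d - s ^ d)%N%:R <= eta * ((s + a) ^ d)%N%:R.
Proof.
move=> eta0; have [s sb] : exists s : nat, d%:R * a%:R / eta <= s.+1%:R.
  exists (Num.bound (d%:R * a%:R / eta)).
  rewrite -natr1 ler_wpDr//; apply/ltW/archi_boundP.
  by rewrite divr_ge0 ?mulr_ge0// ltW.
exists s.+1 => //; set u := s.+1 in sb *.
have u0 : 0 < u%:R :> R by rewrite ltr0n.
have ua0 : 0 < (u + a)%:R :> R by rewrite ltr0n addSn.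
have x01 : 0 <= (u%:R / (u + a)%:R : R) <= 1.
  by rewrite divr_ge0 ?ler0n//= ler_pdivrMr// mul1r ler_nat leq_addr.
rewrite natrB; last by case: (d) => // e; rewrite leq_exp2r ?leq_addr.
have -> : (u ^ d)%N%:R = (u%:R / (u + a)%:R) ^+ d * ((u + a) ^ d)%N%:R :> R.
  by rewrite !natrX -exprMn divfK// gt_eqF.
rewrite -[X in X - _]mul1r -mulrBl ler_wpM2r ?ler0n//.
apply: le_trans (onem_exp_le d x01) _.
have -> : 1 - u%:R / (u + a)%:R = a%:R / (u + a)%:R :> R.
  by rewrite natrD; field; rewrite -natrD gt_eqF.
rewrite mulrA ler_pdivrMr//.
move: sb; rewrite ler_pdivrMr// => /le_trans; apply.
by rewrite mulrC ler_pM2l// ler_nat leq_addr.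
Qed.

(** * Equidistribution of a coarse bijection over the atom types *)

Section coarse_bijection.
Variables (I J : finType) (d c : nat).
Variables (Phi : I * 'cV[int]_d -> J * 'cV[int]_d).
Variables (Psi : J * 'cV[int]_d -> I * 'cV[int]_d).
Hypotheses (PhiK : cancel Phi Psi) (PsiK : cancel Psi Phi).
Hypothesis Psi_coarse : forall j j' l i,
  `|(Psi (j, l)).2 i ord0 - (Psi (j', l)).2 i ord0| <= c%:Z.

Let box_site r (t : I * 'cV['I_r]_d) := (t.1, box c t.2).

Let box_site_inj r : injective (@box_site r).
Proof. by move=> [i k] [i' k'] [-> /box_inj ->]. Qed.

Definition fiber_count (r : nat) (j : J) : nat :=
  #|[set t : I * 'cV['I_r]_d | (Phi (box_site t)).1 == j]|.

Lemma sum_fiber_count (r : nat) :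
  (\sum_j fiber_count r j = #|I| * r ^ d)%N.
Proof.
have <- : #|{: I * 'cV['I_r]_d}| = (#|I| * r ^ d)%N.
  by rewrite card_prod card_mx card_ord muln1.
rewrite -sum1_card (partition_big (fun t => (Phi (box_site t)).1) xpredT)//=.
apply: eq_bigr => j _; rewrite /fiber_count -sum1_card.
by apply: eq_bigl => t; rewrite inE.
Qed.

(* A site of the inner box stays in the outer box when the type of its image
   is changed from [j] to [j']. *)
Lemma fiber_count_le (s : nat) (j j' : J) :
  (fiber_count (c + s + c) j <=
   fiber_count (c + s + c) j' + #|I| * ((c + s + c) ^ d - s ^ d))%N.
Proof.
set r := (c + s + c)%N.
pose sh (t : I * 'cV['I_s]_d) : I * 'cV['I_r]_d :=
  (t.1, map_mx (fun x => lshift c (rshift c x)) t.2).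
have sh_inj : injective sh.
  move=> [i k] [i' k'] [-> /matrixP kk]; congr pair; apply/matrixP => x y.
  by have := kk x y; rewrite !mxE => /lshift_inj/rshift_inj.
pose inn := [set sh t | t in {: I * 'cV['I_s]_d}].
have cinn : #|inn| = (#|I| * s ^ d)%N.
  by rewrite card_imset// card_prod card_mx card_ord muln1.
have cC : #|~: inn| = (#|I| * (r ^ d - s ^ d))%N.
  by rewrite cardsCs finset.setCK cinn card_prod card_mx card_ord muln1 mulnBr.
rewrite /fiber_count; set A := [set t | _]; set A' := [set t | _].
(* The part of the fiber outside the inner box is bounded by the whole shell; the part inside is
   injected into the fiber over [j']. *)
rewrite -cC -(cardsID inn A); apply: leq_add; last first.
  by apply: subset_leq_card; apply/fintype.subsetP => t; rewrite !inE => /andP[].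
(* [f] keeps the cell of the image and changes its type to [j']; on the fiber over [j] the old type
   is known, so [f] is injective there. *)
pose f (t : I * 'cV['I_r]_d) := Psi (j', (Phi (box_site t)).2).
rewrite !cardE -(size_map f) -(size_map (@box_site r) (enum A')).
apply: uniq_leq_size.
  rewrite map_inj_in_uniq ?enum_uniq// => t t'; rewrite !mem_enum !inE.
  move=> /andP[/eqP tj _] /andP[/eqP tj' _] /(can_inj PsiK) [] e.
  apply/box_site_inj/(can_inj PhiK).
  by rewrite (surjective_pairing (Phi (box_site t))) tj e -tj' -surjective_pairing.
move=> p /mapP[t]; rewrite mem_enum inE => /andP[].
rewrite inE => /eqP tj /imsetP[[i k] _ te] ->.
have bt x : - c%:Z <= (f t).2 x ord0 < r%:Z - c%:Z.
  have := Psi_coarse j j' (Phi (box_site t)).2 x.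
  rewrite -{1}tj -surjective_pairing PhiK /f te /box_site /sh /= !mxE /= ler_distl.
  by move: ((Psi _).2 x ord0) (k x ord0) => z [w /= ws]; rewrite /r; lia.
have [k' k'E] := box_surj bt.
have ft : f t = box_site ((f t).1, k') by rewrite /box_site /= k'E -surjective_pairing.
apply/mapP; exists ((f t).1, k') => //.
by rewrite mem_enum inE -ft /f PsiK.
Qed.

(** The counts sum to the number of sites in the box, so summing the pairwise comparison over all
    types compares one count with the average. *)
Lemma fiber_count_equidistributed (R : realType) (s : nat) (j : J) :
  `|#|J|%:R * (fiber_count (c + s + c) j)%:R - #|I|%:R * ((c + s + c) ^ d)%N%:R| <=
  #|J|%:R * #|I|%:R * ((c + s + c) ^ d - s ^ d)%N%:R :> R.
Proof.
rewrite -[in X in _ - X]natrM -sum_fiber_count natr_sum -mulrA.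
have JE (x : R) : #|J|%:R * x = \sum_(j' : J) x.
  by rewrite sumr_const mulr_natl.
rewrite !JE -sumrB; apply: le_trans (ler_norm_sum _ _ _) _.
apply: ler_sum => j' _; rewrite -natrM.
have := fiber_count_le s j j'; have := fiber_count_le s j' j.
rewrite -!(ler_nat R) !natrD ler_norml; lra.
Qed.

(** Both means are read off one large box: the sum of [F] over it is a multiple of the mean of [F],
    while the sum of [G] along [Phi] weights each [G j] by a nearly constant fiber count. The defect
    is negligible for large boxes, so the bound [eps] survives without loss. *)
Lemma mean_close (R : realType) (V : normedModType R) (F : I -> V) (G : J -> V)
    (eps : R) : (0 < #|I|)%N -> (0 < #|J|)%N ->
  (forall p, `|F p.1 - G (Phi p).1| <= eps) ->
  `|#|I|%:R^-1 *: \sum_i F i - #|J|%:R^-1 *: \sum_j G j| <= eps.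
Proof.
move=> I0 J0 FG; set m := \sum_j `|G j|.
have m0 : 0 <= m by apply: sumr_ge0.
apply/ler_addgt0Pr => eta eta0.
(* The defect of equidistribution gets multiplied by [m]; dividing by [1 + m] keeps the product
   within [eta], even if [m] is 0. *)
have eta'0 : 0 < eta / (1 + m) by rewrite divr_gt0// ltr_wpDr.
have [s s0] := box_boundary_small d (c + c) eta'0.
have -> : (s + (c + c) = c + s + c)%N by lia.
set r := (c + s + c)%N => sE.
set n := #|I|%:R : R; set n' := #|J|%:R : R; set M := (r ^ d)%N%:R : R.
have n0 : 0 < n by rewrite ltr0n.
have n'0 : 0 < n' by rewrite ltr0n.
have M0 : 0 < M by rewrite ltr0n expn_gt0 /r addnAC addn_gt0 s0 orbT.
have FE : M *: \sum_i F i = \sum_(t : I * 'cV['I_r]_d) F t.1.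
  rewrite -(pair_bigA _ (fun i (_ : 'cV['I_r]_d) => F i))/= scaler_sumr.
  apply: eq_bigr => i _; rewrite sumr_const card_mx card_ord muln1.
  by rewrite /M scaler_nat.
have GE : \sum_j (fiber_count r j)%:R *: G j =
    \sum_(t : I * 'cV['I_r]_d) G (Phi (box_site t)).1.
  rewrite [RHS](partition_big (fun t => (Phi (box_site t)).1) xpredT)//=.
  apply: eq_bigr => j _; under [RHS]eq_bigr => t /eqP -> do [].
  rewrite sumr_const scaler_nat /fiber_count; congr (_ *+ _).
  by apply: eq_card => t; rewrite !inE.
rewrite -(ler_pM2l (_ : 0 < n * n' * M)); last by rewrite !mulr_gt0.
rewrite -[X in X * `|_|]gtr0_norm; last by rewrite !mulr_gt0.
rewrite -normrZ.
(* After scaling, the difference is the sum of the pointwise errors over the box plus the values of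
   [G] weighted by the deviations of the fiber counts. *)
have -> : n * n' * M *: (n^-1 *: \sum_i F i - n'^-1 *: \sum_j G j) =
  n' *: \sum_(t : I * 'cV['I_r]_d) (F t.1 - G (Phi (box_site t)).1) +
  \sum_j (n' * (fiber_count r j)%:R - n * M) *: G j.
  rewrite sumrB -FE -GE.
  have -> : \sum_j (n' * (fiber_count r j)%:R - n * M) *: G j =
      \sum_j (n' *: ((fiber_count r j)%:R *: G j) - (n * M) *: G j).
    by apply: eq_bigr => j _; rewrite scalerBl scalerA.
  rewrite sumrB -!scaler_sumr !scalerBr !scalerA addrA subrK; congr (_ *: _ - _ *: _).
    by field; rewrite gt_eqF.
  by field; rewrite gt_eqF.
apply: le_trans (ler_normD _ _) _; rewrite mulrDr lerD//.
  rewrite normrZ gtr0_norm// [n * n']mulrC -!mulrA ler_pM2l//.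
  apply: le_trans (ler_norm_sum _ _ _) _.
  apply: le_trans (ler_sum _ (fun t _ => FG (box_site t))) _.
  by rewrite sumr_const card_prod card_mx card_ord muln1 -mulr_natl natrM mulrA.
apply: le_trans (ler_norm_sum _ _ _) _.
apply: (@le_trans _ _ (\sum_j (n' * n * (eta / (1 + m) * M)) * `|G j|)).
  apply: ler_sum => j _; rewrite normrZ ler_wpM2r//.
  apply: le_trans (fiber_count_equidistributed R s j) _.
  by rewrite ler_wpM2l// mulr_ge0// ltW.
rewrite -mulr_sumr -/m.
have -> : n' * n * (eta / (1 + m) * M) * m = n * n' * M * (eta / (1 + m) * m).
  by ring.
rewrite ler_pM2l ?mulr_gt0// mulrAC ler_pdivrMr ?ltr_wpDr//.
by rewrite ler_pM2l// lerDr.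
Qed.

End coarse_bijection.

(** * The Euclidean norm *)

Section euclidean_norm.
Variables (R : realType) (d : nat).
Implicit Types x y z : 'cV[R]_d.

Lemma enorm_ge0 x : 0 <= enorm x.
Proof. exact: sqrtr_ge0. Qed.

Lemma enormN x : enorm (- x) = enorm x.
Proof. by rewrite /enorm; under eq_bigr => i _ do rewrite mxE sqrrN. Qed.

Lemma enorm_distC x y : enorm (x - y) = enorm (y - x).
Proof. by rewrite -enormN opprB. Qed.

Lemma sqr_enorm x : enorm x ^+ 2 = \sum_i x i ord0 ^+ 2.
Proof. by rewrite sqr_sqrtr// sumr_ge0// => i _; exact: sqr_ge0. Qed.

Lemma coord_le_enorm x i : `|x i ord0| <= enorm x.
Proof.
rewrite -(@ler_pXn2r _ 2) ?nnegrE ?enorm_ge0// real_normK ?num_real//.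
rewrite sqr_enorm (bigD1 i)//= lerDl sumr_ge0// => j _; exact: sqr_ge0.
Qed.

Lemma enorm_eq0 x : enorm x = 0 -> forall i, x i ord0 = 0.
Proof. by move=> x0 i; apply/eqP; rewrite -normr_le0 -x0 coord_le_enorm. Qed.

(** For nonzero norms, expand the nonnegative squared norm of [enorm y *: x - enorm x *: y]. *)
Lemma cauchy_schwarz x y : \sum_i x i ord0 * y i ord0 <= enorm x * enorm y.
Proof.
have [/enorm_eq0 x0|x0] := eqVneq (enorm x) 0.
  by rewrite big1 ?mulr_ge0 ?enorm_ge0// => i _; rewrite x0 mul0r.
have [/enorm_eq0 y0|y0] := eqVneq (enorm y) 0.
  by rewrite big1 ?mulr_ge0 ?enorm_ge0// => i _; rewrite y0 mulr0.
have xy0 : 0 < enorm x * enorm y.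
  by rewrite mulr_gt0// lt_neqAle eq_sym ?x0 ?y0 enorm_ge0.
have : 0 <= \sum_i (enorm y * x i ord0 - enorm x * y i ord0) ^+ 2.
  by apply: sumr_ge0 => i _; exact: sqr_ge0.
have -> : \sum_i (enorm y * x i ord0 - enorm x * y i ord0) ^+ 2 =
    2 * (enorm x * enorm y) * (enorm x * enorm y - \sum_i x i ord0 * y i ord0).
  transitivity (enorm y ^+ 2 * (\sum_i x i ord0 ^+ 2) -
      2 * (enorm x * enorm y) * (\sum_i x i ord0 * y i ord0) +
      enorm x ^+ 2 * (\sum_i y i ord0 ^+ 2)).
    rewrite !mulr_sumr -sumrB -big_split; apply: eq_bigr => i _ /=; ring.
  by rewrite -!sqr_enorm; ring.
by rewrite pmulr_rge0 ?subr_ge0// mulr_gt0.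
Qed.

Lemma ler_enormD x y : enorm (x + y) <= enorm x + enorm y.
Proof.
rewrite -(@ler_pXn2r _ 2) ?nnegrE ?addr_ge0 ?enorm_ge0//.
have -> : enorm (x + y) ^+ 2 =
    enorm x ^+ 2 + 2 * (\sum_i x i ord0 * y i ord0) + enorm y ^+ 2.
  rewrite !sqr_enorm mulr_sumr -!big_split; apply: eq_bigr => i _ /=.
  by rewrite mxE; ring.
have := cauchy_schwarz x y; rewrite sqrrD; lra.
Qed.

Lemma enorm_triangle y x z : enorm (x - z) <= enorm (x - y) + enorm (y - z).
Proof. by rewrite -{1}(subrK y x) -addrA ler_enormD. Qed.

Lemma enorm_orthogonal (Q : 'M[R]_d) x : orthogonal_mx Q -> enorm (Q *m x) = enorm x.
Proof.
move=> QQ; rewrite /enorm; congr Num.sqrt.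
have sE (y : 'cV[R]_d) : \sum_i y i ord0 ^+ 2 = (y^T *m y) ord0 ord0.
  by rewrite mxE; apply: eq_bigr => i _; rewrite mxE expr2.
by rewrite !sE trmx_mul mulmxA -(mulmxA _ Q^T) QQ mulmx1.
Qed.

(** Applied to the inverse of a lattice basis, this bounds cell coordinates by distances. *)
Lemma coord_mulmx_le (M : 'M[R]_d) : exists2 K : R, 0 <= K &
  forall x i, `|(M *m x) i ord0| <= K * enorm x.
Proof.
exists (\sum_i \sum_j `|M i j|).
  by apply: sumr_ge0 => i _; apply: sumr_ge0.
move=> x i; rewrite mxE; apply: le_trans (ler_norm_sum _ _ _) _.
apply: (@le_trans _ _ ((\sum_j `|M i j|) * enorm x)).
  rewrite mulr_suml; apply: ler_sum => j _.
  by rewrite normrM ler_wpM2l// coord_le_enorm.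
rewrite ler_wpM2r ?enorm_ge0// [leRHS](bigD1 i)//= lerDl.
by apply: sumr_ge0 => k _; apply: sumr_ge0.
Qed.

End euclidean_norm.

(** * Sites of a periodic unit, labelled by atom and cell *)

Section lattice_sites.
Variables (R : realType) (n : nat) (X : 'M[R]_(3, n)) (L : 'M[R]_3).
Implicit Types (k l : 'cV[int]_3) (s t : 'I_n * 'cV[int]_3).

Lemma lattice_vecB k l : lattice_vec L (k - l) = lattice_vec L k - lattice_vec L l.
Proof. by rewrite /lattice_vec -mulmxBr -map_mxB. Qed.

Definition site s : 'cV[R]_3 := col s.1 X + lattice_vec L s.2.

Definition site_dist s t : R := enorm (site s - site t).

Lemma site_dist_ge0 s t : 0 <= site_dist s t.
Proof. exact: enorm_ge0. Qed.

(** Translating by a lattice vector brings [t] to the cell 0, where the network measures its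
    distances. *)
Lemma site_dist_shift s t : site_dist s t = neighbor_dist X L t.1 (s.1, s.2 - t.2).
Proof.
rewrite /site_dist /neighbor_dist /site /= lattice_vecB; congr enorm.
by rewrite opprD addrACA addrAC.
Qed.

Lemma site_inj : is_periodic_unit X L -> injective site.
Proof.
move=> [_ XL] [i k] [j l] e; apply: contrapT => ij.
have /XL : j <> i \/ k - l <> 0.
  have [ji|ji] := eqVneq j i; last by left; apply/eqP.
  by right => /eqP; rewrite subr_eq0 => /eqP kl; apply: ij; rewrite ji kl.
rewrite lattice_vecB; apply; apply/esym/eqP.
by rewrite addrA -subr_eq opprK; apply/eqP/esym.
Qed.

(** Two sites differ by a lattice vector plus an offset between atoms of one cell. The offset is at
    most [m], and [invmx L] turns the lattice vector into the difference of the cells. *)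
Lemma cell_bounded (M : R) : L \in unitmx -> exists c : nat,
  forall s t, site_dist s t <= M -> forall i, `|s.2 i ord0 - t.2 i ord0| <= c%:Z.
Proof.
move=> Lu; have [K K0 KP] := coord_mulmx_le (invmx L).
pose m := \sum_i \sum_j enorm (col i X - col j X).
have m0 : 0 <= m.
  by apply: sumr_ge0 => ? _; apply: sumr_ge0 => ? _; exact: enorm_ge0.
pose c := Num.bound (K * (M + m)); exists c => s t st i.
have -> : s.2 i ord0 - t.2 i ord0 = (s.2 - t.2) i ord0 by rewrite !mxE.
rewrite -(ler_int R) intr_norm.
have -> : ((s.2 - t.2) i ord0)%:~R =
    (invmx L *m lattice_vec L (s.2 - t.2)) i ord0 :> R.
  by rewrite /lattice_vec mulKmx// [RHS]mxE.
apply: le_trans (KP _ _) _; apply: ltW; apply: le_lt_trans (archi_boundP _); last first.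
  have M0 : 0 <= M by exact: le_trans (site_dist_ge0 s t) st.
  by rewrite mulr_ge0// addr_ge0.
rewrite ler_wpM2l//.
have -> : lattice_vec L (s.2 - t.2) = (site s - site t) - (col s.1 X - col t.1 X).
  by rewrite lattice_vecB /site opprD addrACA [RHS]addrAC subrr add0r.
apply: le_trans (ler_enormD _ _) _; rewrite enormN lerD//.
rewrite /m (bigD1 s.1)//= (bigD1 t.1)//= -addrA lerDl.
by rewrite addr_ge0// ?sumr_ge0// => ? _; rewrite ?sumr_ge0 ?enorm_ge0// => ? _;
  exact: enorm_ge0.
Qed.

End lattice_sites.

(** * Continuity and locality of the messages *)

Section message_passing.
Variables (R : realType) (Sp : finType) (N : network R Sp).

(* The envelope is cut off at [D] through the minimum, and the edge feature is
   extended evenly to negative distances, so that this is continuous everywhere. *)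
Definition contribution (z : 'cV[R]_(dv N) * 'cV[R]_(dv N) * R) : 'cV[R]_(dv N) :=
  (cos (pi * Num.min z.2 (cutoff N) / (2 * cutoff N)) ^+ 2) *:
    message z.1.1 z.1.2 (edge_feature N `|z.2|).

Lemma edge_feature_norm_continuous : continuous (fun t : R => edge_feature N `|t|).
Proof.
move=> t; have /subspace_continuousP/(_ `|t|) := @edge_feature_continuous _ _ N.
move=> /(_ (normr_ge0 t)) /= ft; apply: (cvg_comp _ _ _ ft).
move=> A; rewrite /within/= => tA.
have /= : \forall u \near t, 0 <= `|u| -> A `|u|.
  by exact: (@norm_continuous _ R^o t _ tA).
by apply: filterS => u /=; apply; exact: normr_ge0.
Qed.

Lemma contribution_continuous : continuous contribution.
Proof.
pose V := 'cV[R]_(dv N); move=> z; apply: cvgZ.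
  pose a (w : V * V * R) := pi * Num.min w.2 (cutoff N) / (2 * cutoff N).
  apply: (@continuous_comp _ _ _ (cos \o a) (fun x => x ^+ 2));
    last exact: exprn_continuous.
  apply: (@continuous_comp _ _ _ a cos); last exact: continuous_cos.
  apply: cvgMl; apply: cvgMr.
  apply: (@continuous_min R _ (fun w : V * V * R => w.2 : R^o) (fun=> cutoff N)).
    exact: cvg_snd.
  exact: cvg_cst.
pose g (w : V * V * R) : V * V * 'cV[R]_(de N) := (w.1, edge_feature N `|w.2|).
apply: (@continuous_comp _ _ _ g (fun w => message w.1.1 w.1.2 w.2));
  last exact: message_continuous.
apply: (@cvg_pair _ _ _ (nbhs z) (nbhs z.1) (nbhs (edge_feature N `|z.2|))
  _ _ _ fst (fun w => edge_feature N `|w.2|)); first exact: cvg_fst.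
apply: (@continuous_comp _ _ _ snd (fun t => edge_feature N `|t|));
  first exact: cvg_snd.
exact: edge_feature_norm_continuous.
Qed.

Lemma contribution_cutoff u v (t : R) : cutoff N <= t -> contribution (u, v, t) = 0.
Proof.
move=> Dt; rewrite /contribution /= min_r//.
have -> : pi * cutoff N / (2 * cutoff N) = pi / 2.
  by field; rewrite gt_eqF// cutoff_gt0.
by rewrite cos_pihalf expr0n scale0r.
Qed.

(** Sites beyond the cutoff contribute 0, so any finite family covering the neighborhood may index
    the sum. Two updates can thus be compared over one index type even if their neighborhoods do not
    correspond. *)
Lemma update_eq_sum n (X : 'M[R]_(3, n)) (L : 'M[R]_3) (v : 'I_n -> 'cV[R]_(dv N))
    (s : 'I_n * 'cV[int]_3) (T : finType) (e : T -> 'I_n * 'cV[int]_3) :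
  injective e -> (forall p, site_dist X L p s < cutoff N -> exists t, e t = p) ->
  update X L v s.1 =
  v s.1 + \sum_t contribution (v s.1, v (e t).1, site_dist X L (e t) s).
Proof.
move=> einj ecover; rewrite /update; congr (_ + _).
pose e' t := ((e t).1, (e t).2 - s.2).
have e'E t : site_dist X L (e t) s = neighbor_dist X L s.1 (e' t).
  by rewrite site_dist_shift.
have e'inj : injective e'.
  move=> t t' [] e1 /addIr e2; apply: einj.
  by rewrite (surjective_pairing (e t)) e1 e2 -surjective_pairing.
pose f jk := contribution (v s.1, v jk.1, neighbor_dist X L s.1 jk).
transitivity (\sum_(jk \in neighbors N X L s.1) f jk).
  apply: eq_fsbigr => jk; rewrite inE /neighbors /= => jkD.
  by rewrite /f /contribution /= (min_l (ltW jkD)) ger0_norm ?enorm_ge0.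
rewrite (fsbig_fwiden [seq e' t | t <- enum T]).
- by rewrite big_map big_enum; apply: eq_bigr => t _; rewrite e'E.
- move=> [j h] jkD; have [|t et] := ecover (j, h + s.2).
    by rewrite site_dist_shift /= addrK.
  by apply/mapP; exists t; rewrite ?mem_enum// /e' et /= addrK.
- by rewrite map_inj_uniq ?enum_uniq.
- move=> jk [_] /= /negP; rewrite /neighbors/= -leNgt => Dj.
  exact: contribution_cutoff.
Qed.

End message_passing.

(** * Bijections of sites that nearly preserve distances *)

Section almost_isometries.
Variables (R : realType) (Sp : finType).
Implicit Types P : periodic_unit R Sp.

Definition unit_dist P := site_dist (coords P) (lattice P).

(** Stated on labels rather than points, because features depend on the atom label only; of the
    displacement, only the distortion of distances is kept. *)
Definition almost_isometry (delta : R) P P'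
    (Phi : 'I_(natoms P) * 'cV[int]_3 -> 'I_(natoms P') * 'cV[int]_3) : Prop :=
  [/\ bijective Phi,
      forall s, tnth (species P') (Phi s).1 = tnth (species P) s.1 &
      forall s t, `|unit_dist (Phi s) (Phi t) - unit_dist s t| < delta].

(** Distinct labels give distinct points, so the bijection lifts to labels; each end of a segment
    moves by less than [delta], whence the factor 2. *)
Lemma displaced_almost_isometry delta P P' :
  displaced_below delta (PtoS P) (PtoS P') ->
  exists Phi, @almost_isometry (2 * delta) P P' Phi.
Proof.
pose pt P s := (tnth (species P) s.1, site (coords P) (lattice P) s).
have pt_inj P0 : injective (pt P0).
  by move=> s t [_ /site_inj]; apply; exact: periodic_unitP.
have ptP P0 s : sites (PtoS P0) (pt P0 s) by exists s.1, s.2.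
move=> [phi [[phi_fun phi_inj phi_surj] phi_disp]].
have [Phi PhiE] : {Phi & forall s, phi (pt P s) = pt P' (Phi s)}.
  apply: (@choice _ _ (fun s s' => phi (pt P s) = pt P' s')) => s.
  have /phi_fun [j [l e]] := ptP P s.
  by exists (j, l); rewrite e.
have [Psi PsiE] : {Psi & forall s, phi (pt P (Psi s)) = pt P' s}.
  apply: (@choice _ _ (fun s s' => phi (pt P s') = pt P' s)) => s.
  have /phi_surj [p [i [k pE]] e] := ptP P' s.
  by exists (i, k); rewrite -e pE.
have disp s : enorm (site (coords P') (lattice P') (Phi s) -
    site (coords P) (lattice P) s) < delta.
  by have [_] := phi_disp _ (ptP P s); rewrite PhiE.
exists Phi; split.
- exists Psi => s; last by apply: (pt_inj P'); rewrite -PhiE PsiE.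
  by apply/(pt_inj P)/phi_inj; rewrite ?PsiE ?PhiE//; apply/mem_set/ptP.
- by move=> s; have [] := phi_disp _ (ptP P s); rewrite PhiE.
- move=> s t; rewrite /unit_dist /site_dist.
  set x := site _ _ s; set y := site _ _ t.
  set x' := site _ _ (Phi s); set y' := site _ _ (Phi t).
  have xd : enorm (x' - x) < delta := disp s.
  have yd : enorm (y' - y) < delta := disp t.
  have := enorm_triangle x x' y'; have := enorm_triangle y x y'.
  have := enorm_triangle x' x y; have := enorm_triangle y' x' y.
  rewrite (enorm_distC x x') (enorm_distC y y') ltr_norml; lra.
Qed.

(** Sites in one cell of [P'] are at distance at most [m], so their preimages are within [m + delta]
    and lie in cells a bounded number of steps apart: the inverse is coarse. *)
Lemma almost_isometry_mean_close delta P P' Phi (V : normedModType R)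
    (F : 'I_(natoms P) -> V) (G : 'I_(natoms P') -> V) (eps : R) :
  @almost_isometry delta P P' Phi ->
  (forall s, `|F s.1 - G (Phi s).1| <= eps) ->
  `|(natoms P)%:R^-1 *: \sum_i F i - (natoms P')%:R^-1 *: \sum_j G j| <= eps.
Proof.
move=> [[Psi PhiK PsiK] _ Phid] FG.
pose m := \sum_(j < natoms P') \sum_(j' < natoms P') unit_dist (j, 0) (j', 0).
have [Lu _] := periodic_unitP P.
have [c cP] := cell_bounded (coords P) (m + delta) Lu.
have Psi_coarse j j' l i : `|(Psi (j, l)).2 i ord0 - (Psi (j', l)).2 i ord0| <= c%:Z.
  apply: cP; have := Phid (Psi (j, l)) (Psi (j', l)); rewrite !PsiK.
  have : unit_dist (j, l) (j', l) <= m.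
    have -> : unit_dist (j, l) (j', l) = unit_dist (j, 0) (j', 0).
      by rewrite /unit_dist !site_dist_shift /= !subrr.
    rewrite /m (bigD1 j)//= (bigD1 j')//= -addrA lerDl addr_ge0//.
      by apply: sumr_ge0 => ? _; exact: enorm_ge0.
    by apply: sumr_ge0 => ? _; apply: sumr_ge0 => ? _; exact: enorm_ge0.
  rewrite ltr_norml /unit_dist; lra.
have := mean_close PhiK PsiK Psi_coarse _ _ FG.
by rewrite !card_ord; apply; exact: natoms_gt0.
Qed.

(** Comparing means of species indicators with error 0 gives equal frequencies, so the counts are
    proportional; dividing by the gcd removes the factor. *)
Lemma almost_isometry_reduce delta P P' Phi :
  @almost_isometry delta P P' Phi -> reduce (species P') = reduce (species P).
Proof.
move=> PhiP; have [_ PhiS _] := PhiP.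
pose F P0 a i : R := (tnth (species P0) i == a)%:R.
have FE P0 a : \sum_i F P0 a i = (count_mem a (species P0))%:R.
  rewrite -sum1_count natr_sum [RHS]big_mkcond [RHS]big_tuple.
  by apply: eq_bigr => i _; rewrite /F /=; case: eqP.
have cE a :
    (natoms P * count_mem a (species P') = natoms P' * count_mem a (species P))%N.
  have : forall s, `|F P a s.1 - F P' a (Phi s).1| <= 0.
    by move=> s; rewrite /F PhiS subrr normr0.
  move=> /(@almost_isometry_mean_close _ _ _ _ R^o (F P a) (F P' a) _ PhiP) h.
  have {h} : `|(natoms P)%:R^-1 * \sum_i F P a i -
      (natoms P')%:R^-1 * \sum_i F P' a i| <= 0 := h.
  rewrite !FE normr_le0 subr_eq0.
  have n0 P0 : (natoms P0)%:R != 0 :> R by rewrite pnatr_eq0 -lt0n natoms_gt0.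
  rewrite ![_^-1 * _]mulrC eqr_div// -!natrM eqr_nat => /eqP e.
  by rewrite mulnC -e mulnC.
apply/ffunP => a; rewrite !ffunE.
rewrite -[LHS](divnMl (natoms_gt0 P)) -[RHS](divnMl (natoms_gt0 P')).
have gE P0 n : (n * \big[gcdn/0]_b count_mem b (species P0) =
    \big[gcdn/0]_b (n * count_mem b (species P0)))%N.
  by apply: (big_morph (muln n)) => [x y|]; rewrite ?muln0// muln_gcdr.
rewrite !gE cE; congr (_ %/ _)%N; apply: eq_bigr => b _; exact: cE.
Qed.

End almost_isometries.

(** * Stability of the features and of the energy *)

Section stability.
Variables (R : realType) (Sp : finType) (N : network R Sp).
Implicit Types P : periodic_unit R Sp.

Definition features (r : nat) P : 'I_(natoms P) -> 'cV[R]_(dv N) :=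
  iter r (update (coords P) (lattice P)) (fun i => node_init N (tnth (species P) i)).

(** Phrased with a filter at 0 so that finitely many moduli of continuity can be intersected. *)
Lemma continuous_ball (U V : pseudoMetricType R) (f : U -> V) (z : U) (eps : R) :
  continuous f -> 0 < eps ->
  \forall eta \near (0 : R)^'+%classic,
    forall z', ball z eta z' -> ball (f z) eps (f z').
Proof.
move=> fc eps0; have /nbhs_ballP[e e0 ze] := fc z _ (nbhsx_ballx (f z) _ eps0).
near=> eta; move=> z' zz'; apply: ze; apply: le_ball zz'.
by near: eta; exact: nbhs_right_le.
Unshelve. all: by end_near. Qed.

(** [delta] must depend on [P] alone. By periodicity, the update involves only finitely many
    argument triples up to translation, so one modulus of continuity serves all sites. *)
Lemma features_close (r : nat) P (eps : R) : 0 < eps -> exists2 delta : R, 0 < delta &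
  forall P' Phi, @almost_isometry R Sp delta P P' Phi ->
  forall s, `|features r s.1 - features r (Phi s).1| < eps.
Proof.
elim: r eps => [|r IH] eps eps0.
  by exists 1 => // P' Phi [_ PhiS _] s; rewrite /features /= PhiS subrr normr0.
have [Lu _] := periodic_unitP P.
(* The margin 1 ensures that every neighbor of [Phi s] is the image of a site in the window around
   [s], as distances change by less than 1. *)
have [c cP] := cell_bounded (coords P) (cutoff N + 1) Lu.
pose T : finType := ('I_(natoms P) * 'cV['I_(c + c).+1]_3)%type.
pose e (t : T) := (t.1, box c t.2).
pose z (i : 'I_(natoms P)) t :=
  (features r i, features r (e t).1, unit_dist (e t) (i, 0)).
(* Half of [eps] is for the old feature, half is shared among the messages; the successor avoids a
   zero divisor. *)
pose eps' := eps / 2 / #|T|.+1%:R.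
have eps'0 : 0 < eps' by rewrite !divr_gt0.
have : \forall eta \near (0 : R)^'+%classic, forall i t z', ball (z i t) eta z' ->
    ball (contribution (z i t)) eps' (contribution z').
  apply: filter_forall => i; apply: filter_forall => t.
  exact: continuous_ball (@contribution_continuous _ _ N) eps'0.
move=> near_eta.
have [eta [eta_gt0 eta_le etaP]] : exists eta : R, [/\ 0 < eta, eta <= eps / 2 &
    forall i t z', ball (z i t) eta z' ->
    ball (contribution (z i t)) eps' (contribution z')].
  apply: (@filter_ex _ ((0 : R)^'+%classic)); near=> eta; split.
  - by near: eta; exact: nbhs_right_gt.
  - by near: eta; apply: nbhs_right_le; rewrite divr_gt0.
  - by near: eta.
have [delta delta0 deltaP] := IH eta eta_gt0.
exists (Num.min delta (Num.min eta 1)); first by rewrite !lt_min delta0 eta_gt0 ltr01.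
move=> P' Phi [Phib PhiS Phid] s.
have fclose t : `|features r t.1 - features r (Phi t).1| < eta.
  apply: deltaP; split=> // u v; apply: lt_le_trans (Phid u v) _.
  by rewrite ge_min lexx.
pose sh (t : T) := ((e t).1, (e t).2 + s.2).
have sh_inj : injective sh by move=> [i k] [j l] [-> /addIr/box_inj ->].
have sh_dist t : unit_dist (sh t) s = unit_dist (e t) (s.1, 0).
  by rewrite /unit_dist !site_dist_shift /= addrK subr0.
have sh_cover p : unit_dist p s < cutoff N + 1 -> exists t, sh t = p.
  move=> ps; have pb x : - c%:Z <= (p.2 - s.2) x ord0 < (c + c).+1%:Z - c%:Z.
    have := cP _ _ (ltW ps) x; rewrite ler_norml !mxE.
    move: (p.2 x ord0) (s.2 x ord0) => a b; lia.
  have [k kE] := box_surj pb; exists (p.1, k).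
  by rewrite /sh /= kE subrK -surjective_pairing.
rewrite /features !iterS -!/(features r).
rewrite (update_eq_sum _ sh_inj) => [|p ps]; last first.
  by apply: sh_cover; apply: lt_trans ps _; rewrite ltrDl.
rewrite (update_eq_sum _ (inj_comp (bij_inj Phib) sh_inj)) => [|p ps]; last first.
  have [Psi PhiK PsiK] := Phib.
  have [|t tp] := sh_cover (Psi p); last by exists t; rewrite /= tp PsiK.
  have := Phid (Psi p) s; rewrite PsiK !lt_min !ltr_norml => /andP[_ /andP[_ /andP[]]].
  rewrite /unit_dist; lra.
rewrite opprD addrACA -sumrB; apply: le_lt_trans (ler_normD _ _) _.
rewrite [eps]splitr ltr_leD//; first exact: lt_le_trans (fclose s) eta_le.
apply: le_trans (ler_norm_sum _ _ _) _.
apply: (@le_trans _ _ (\sum_(t : T) eps')).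
  apply: ler_sum => t _; apply: ltW.
  have /etaP : ball (z s.1 t) eta (features r (Phi s).1, features r (Phi (sh t)).1,
      unit_dist (Phi (sh t)) (Phi s)).
    rewrite /z -sh_dist; split; [split|]; rewrite -ball_normE /=.
    - exact: fclose.
    - exact: (fclose (sh t)).
    - rewrite distrC; apply: lt_le_trans (Phid _ _) _.
      by rewrite !ge_min lexx !orbT.
  by rewrite -ball_normE /z -sh_dist.
have <- : eps' * #|T|.+1%:R = eps / 2 by rewrite divfK ?pnatr_eq0.
by rewrite sumr_const -[eps' *+ _]mulr_natr ler_pM2l// ler_nat.
Unshelve. all: by end_near. Qed.

(** Continuity of the readout at the single point [mean P] suffices, since that point is fixed
    before [P'] is given. *)
Lemma energy_close P (eps : R) : 0 < eps -> exists2 delta : R, 0 < delta &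
  forall P' Phi, @almost_isometry R Sp delta P P' Phi ->
  `|energy N P - energy N P'| < eps.
Proof.
move=> eps0.
pose mean P0 : 'cV[R]_(dv N) := (natoms P0)%:R^-1 *: \sum_i @features (rounds N) P0 i.
have near_eta := continuous_ball (mean P) (@readout_continuous _ _ N) eps0.
have [eta [eta_gt0 etaP]] : exists eta : R, 0 < eta /\
    forall z', ball (mean P) eta z' -> ball (readout (mean P)) eps (readout z').
  apply: (@filter_ex _ ((0 : R)^'+)%classic); near=> eta; split.
  - by near: eta; exact: nbhs_right_gt.
  - by near: eta.
(* The mean comparison only gives a large inequality; halving makes it strict. *)
have eta2 : 0 < eta / 2 by rewrite divr_gt0.
have [delta delta0 deltaP] := features_close (rounds N) P eta2.
exists delta => // P' Phi PhiP.
have : ball (readout (mean P)) eps (readout (mean P')).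
  apply: etaP; rewrite -ball_normE /=.
  apply: (@le_lt_trans _ _ (eta / 2)); last lra.
  apply: (almost_isometry_mean_close PhiP) => s.
  exact/ltW/(deltaP _ _ PhiP).
by rewrite -ball_normE; exact.
Unshelve. all: by end_near. Qed.

End stability.

(** * Invariance and continuity of the loss *)

Section loss.
Variables (R : realType) (Sp : finType) (N : network R Sp).
Variables (expand : {ffun Sp -> nat} -> nat -> seq Sp) (m : nat) (beta q rest : R).
Local Notation loss := (loss N expand m beta q rest).

Lemma material_eq (S T : material R Sp) : sites S = sites T -> S = T.
Proof.
case: S T => [s cs] [t ct] /= st; move: ct; rewrite -st => ct.
by congr Material; exact: Prop_irrelevance.
Qed.

(** Take the lattice [Q *m L] and the coordinates moved by the isometry: all neighbor distances
    agree, hence so do all updates. *)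
Lemma isometric_copy (P : periodic_unit R Sp) (Q : 'M[R]_3) (b : 'cV[R]_3) :
  orthogonal_mx Q -> exists P' : periodic_unit R Sp,
  [/\ sites (PtoS P') = [set (p.1, Q *m p.2 + b) | p in sites (PtoS P)]%classic,
      energy N P' = energy N P & reduce (species P') = reduce (species P)].
Proof.
move=> QQ; case: P => n n0 A X L XL.
pose X' : 'M[R]_(3, n) := \matrix_(i, j) ((Q *m X) i j + b i ord0).
have colX' j : col j X' = Q *m col j X + b.
  apply/colP => i; rewrite !mxE; congr (_ + b i _).
  by apply: eq_bigr => l _; rewrite mxE.
have latQ k : lattice_vec (Q *m L) k = Q *m lattice_vec L k.
  by rewrite /lattice_vec mulmxA.
have siteQ j k : col j X' + lattice_vec (Q *m L) k =
    Q *m (col j X + lattice_vec L k) + b.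
  by rewrite colX' latQ mulmxDr addrAC.
have XL' : is_periodic_unit X' (Q *m L).
  have [Lu Xinj] := XL; split.
    by rewrite unitmx_mul Lu andbT; have [] := mulmx1_unit QQ.
  move=> i j k ijk; rewrite siteQ colX' => /addIr /(congr1 (mulmx Q^T)).
  by rewrite !mulmxA QQ !mul1mx; exact: Xinj.
exists (PeriodicUnit n0 A XL'); split=> //.
- apply/seteqP; split=> p /=.
    by move=> [i [k ->]]; eexists; [exists i, k|rewrite /= siteQ].
  by move=> [_ [i [k ->]] <-]; exists i, k; rewrite /= siteQ.
- have distE : neighbor_dist X' (Q *m L) = neighbor_dist X L.
    apply/funext => i; apply/funext => jk; rewrite /neighbor_dist siteQ colX'.
    by rewrite opprD addrACA subrr addr0 -mulmxBr enorm_orthogonal.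
  have updateE : @update R Sp N n X' (Q *m L) = update X L.
    by apply/funext => v; apply/funext => i; rewrite /update /neighbors distE.
  by rewrite /energy /energy_of /node_features /= updateE.
Qed.

(** Equal compositions make the normalization terms cancel, leaving the energy difference times
    [beta / m]. *)
Lemma loss_close (P : periodic_unit R Sp) (eps : R) : 0 < eps ->
  exists2 delta : R, 0 < delta & forall P',
    displaced_below delta (PtoS P) (PtoS P') -> `|loss P' - loss P| < eps.
Proof.
move=> eps0; pose C := 1 + `|m%:R^-1 * beta|.
have C0 : 0 < C by rewrite ltr_pwDl.
have [delta delta0 deltaP] := energy_close N P (divr_gt0 eps0 C0).
exists (delta / 2); first by rewrite divr_gt0.
move=> P' /displaced_almost_isometry[Phi]; rewrite mulrC divfK ?pnatr_eq0// => PhiP.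
have -> : loss P' - loss P = - (m%:R^-1 * beta * (energy N P - energy N P')).
  by rewrite /Defs.loss (almost_isometry_reduce PhiP); ring.
rewrite normrN normrM.
have := deltaP _ _ PhiP; rewrite ltr_pdivlMr// mulrC; apply: le_lt_trans.
by rewrite ler_wpM2r// lerDr.
Qed.

Lemma displaced_refl delta (S : material R Sp) : 0 < delta -> displaced_below delta S S.
Proof.
move=> delta0; exists id; split.
  by split=> // p Sp0; exists p.
move=> p _; split=> //; rewrite subrr.
by rewrite /enorm big1 ?sqrtr0// => i _; rewrite mxE expr0n.
Qed.

Lemma loss_redescription_invariant : strongly_redescription_invariant loss.
Proof.
move=> P P' PP'; apply/eqP; rewrite -subr_eq0 -normr_eq0; apply/eqP/le_anti.
rewrite normr_ge0 andbT; apply/ler_addgt0Pr => eps eps0; rewrite add0r.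
have [delta delta0 deltaP] := loss_close P eps0.
by apply/ltW/deltaP; rewrite PP'; exact: displaced_refl.
Qed.

(** Covers translations with [Q = 1] and rotations with [b = 0]; the isometric copy shows that the
    moved material stays in the domain. *)
Lemma descend_loss_isometry (S T : material R Sp) (Q : 'M[R]_3) (b : 'cV[R]_3) :
  orthogonal_mx Q ->
  sites T = [set (p.1, Q *m p.2 + b) | p in sites S]%classic ->
  in_dom (descend loss) S -> descend loss T = descend loss S.
Proof.
move=> QQ TS /in_dom_descend[P _ PS]; move: TS; rewrite -PS => TS.
have [P' [P'E eE rE]] := isometric_copy P b QQ.
have -> : T = PtoS P' by apply: material_eq; rewrite TS -P'E.
rewrite !descend_PtoS; [|exact: loss_redescription_invariant..].
by rewrite /Defs.loss eE rE.
Qed.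

Lemma loss_translation_invariant : translation_invariant (descend loss).
Proof.
move=> S b; apply: (@descend_loss_isometry _ _ 1%:M b).
  by rewrite /orthogonal_mx trmx1 mulmx1.
by congr image; apply/funext => p; rewrite mul1mx.
Qed.

Lemma loss_rotation_invariant : rotation_invariant (descend loss).
Proof.
move=> S Q Sdom QQ; apply: (@descend_loss_isometry _ _ Q 0) => //.
by congr image; apply/funext => p; rewrite addr0.
Qed.

Lemma loss_continuous : material_continuous (V := R^o) (descend loss).
Proof.
move=> S y; rewrite {1}/descend; case: pselect => // exP [<-] eps eps0.
case: cid => P /= PS.
have [delta delta0 deltaP] := loss_close P eps0; exists delta => // S' y'.
rewrite /descend; case: pselect => // exP' [<-]; case: cid => P' /= P'S'.
by rewrite -PS -P'S'; exact: deltaP.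
Qed.

End loss.

Theorem theorem6 (R : realType) (Sp : finType) (N : network R Sp)
    (expand : {ffun Sp -> nat} -> nat -> seq Sp) (hexpand : is_expand expand)
    (m : nat) (hm : (0 < m)%N) (beta : R) (hbeta : 0 < beta)
    (q : R) (hq0 : 0 < q) (hq1 : q <= 1) (rest : R) :
  strongly_redescription_invariant (loss N expand m beta q rest) /\
  translation_invariant (descend (loss N expand m beta q rest)) /\
  rotation_invariant (descend (loss N expand m beta q rest)) /\
  material_continuous (V := R^o) (descend (loss N expand m beta q rest)).
Proof.
split; first exact: loss_redescription_invariant.
split; first exact: loss_translation_invariant.
by split; [exact: loss_rotation_invariant|exact: loss_continuous].
Qed.
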